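(* Let $n,m,l\in\mathbb{N}$ and let $F:\mathbb{P}_n\times\mathbb{P}_m\to\mathbb{P}_l$ be a function. Consider the conditions: (a) $(A,B)\mapsto\|F(A,B)\|_!$ is jointly concave for every symmetric anti-norm $\|\cdot\|_!$ on $\mathbb{M}_l^+$; (a)$'$ $(A,B)\mapsto\|F(A,B)\|_{\{k\}}$ is jointly concave for every Ky Fan $k$-anti-norm, $1\le k\le l$; (b) $(A,B)\mapsto\|F(A,B)^{-1}\|$ is jointly convex for every symmetric norm $\|\cdot\|$ on $\mathbb{M}_l$; (b)$'$ $(A,B)\mapsto\|F(A,B)^{-1}\|_{(k)}$ is jointly convex for every Ky Fan $k$-norm, $1\le k\le l$; (c) $(A,B)\mapsto\mathrm{Tr}\, f(F(A,B))$ is jointly concave for every non-decreasing concave function $f$ on $(0,\infty)$; (d) $(A,B)\mapsto\mathrm{Tr}\, f(F(A,B)^{-1})$ is jointly convex for every non-decreasing convex function $f$ on $(0,\infty)$. Then (a) $\Leftrightarrow$ (a)$'$ $\Rightarrow$ (b) $\Leftrightarrow$ (b)$'$ $\Rightarrow$ (d), and (a) $\Rightarrow$ (c) $\Rightarrow$ (d).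
   Context: $\mathbb{M}_l$: $l\times l$ complex matrices; $\mathbb{M}_l^+$: positive semidefinite ones; $\mathbb{P}_l$: positive definite ones. A symmetric norm on $\mathbb{M}_l$ is a norm with $\|UXV\|=\|X\|$ for all unitaries $U,V$. A symmetric anti-norm $\|\cdot\|_!$ on $\mathbb{M}_l^+$ is a non-negative continuous functional with $\|\lambda A\|_!=\lambda\|A\|_!$, $\|UAU^*\|_!=\|A\|_!$, $\|A+B\|_!\ge\|A\|_!+\|B\|_!$ for all $A,B\in\mathbb{M}_l^+$, $\lambda\ge0$, unitaries $U$. With $\lambda_1(A)\ge\dots\ge\lambda_l(A)$ the eigenvalues of $A\in\mathbb{M}_l^+$ with multiplicities, the Ky Fan $k$-norm is $\|A\|_{(k)}=\sum_{j=1}^k\lambda_j(A)$ and the Ky Fan $k$-anti-norm is $\|A\|_{\{k\}}=\sum_{j=1}^k\lambda_{l+1-j}(A)$. *)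

(* Defs.v *)
From HB Require Import structures.
From mathcomp Require Import all_boot all_order all_algebra.
From mathcomp Require Import reals.
From mathcomp Require Import complex.
Set Implicit Arguments.
Unset Strict Implicit.
Unset Printing Implicit Defensive.
Import Order.TTheory GRing.Theory Num.Theory.
Local Open Scope ring_scope.
Local Open Scope sesquilinear_scope.

Section Defs.
Variable R : realType.
Local Notation C := (R[i]).

Definition cR (x : R) : C := Complex x 0.

Definition cabs (a : C) : R := complex.Re `|a|.

Definition adj {p q} (M : 'M[C]_(p, q)) : 'M[C]_(q, p) := M ^t*.

Definition psdmx {p} (A : 'M[C]_p) : Prop :=
  adj A = A /\ forall v : 'cV[C]_p, 0 <= (adj v *m A *m v) 0 0.
Definition pdmx {p} (A : 'M[C]_p) : Prop :=
  adj A = A /\ forall v : 'cV[C]_p, v != 0 -> 0 < (adj v *m A *m v) 0 0.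

(* eigenvalues (with multiplicity) of a Hermitian matrix, via the spectral
   decomposition A = U^-1 diag(d) U of the library; they are real. *)
Definition eigs {p} (A : 'M[C]_p) : seq R :=
  sort (fun x y => y <= x) [seq complex.Re (spectral_diag A 0 i) | i <- enum 'I_p].
(* lambda_j(A), j = 1..p, in non-increasing order *)
Definition eigval {p} (A : 'M[C]_p) (j : nat) : R := nth 0 (eigs A) j.-1.

(* Ky Fan k-norm and k-anti-norm on M_p^+ *)
Definition kyfan_norm {p} (k : nat) (A : 'M[C]_p) : R :=
  \sum_(1 <= j < k.+1) eigval A j.
Definition kyfan_antinorm {p} (k : nat) (A : 'M[C]_p) : R :=
  \sum_(1 <= j < k.+1) eigval A (p + 1 - j).

Definition mxfun {p} (f : R -> R) (A : 'M[C]_p) : 'M[C]_p :=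
  invmx (spectralmx A) *m diag_mx (\row_i cR (f (complex.Re (spectral_diag A 0 i))))
    *m spectralmx A.

Definition symmetric_norm {p} (N : 'M[C]_p -> R) : Prop :=
  [/\ forall X, 0 <= N X,
      forall X, N X = 0 -> X = 0,
      forall (a : C) X, N (a *: X) = cabs a * N X,
      forall X Y, N (X + Y) <= N X + N Y &
      forall U V X, U \is unitarymx -> V \is unitarymx ->
        N (U *m X *m V) = N X].

Definition continuous_on_psd {p} (N : 'M[C]_p -> R) : Prop :=
  forall A, psdmx A -> forall e : R, 0 < e -> exists2 d : R, 0 < d &
    forall B, psdmx B -> (forall i j, cabs (B i j - A i j) < d) ->
      `|N B - N A| < e.

(* symmetric anti-norm on M_p^+ (only its values on M_p^+ matter) *)
Definition symmetric_antinorm {p} (N : 'M[C]_p -> R) : Prop :=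
  [/\ forall A, psdmx A -> 0 <= N A,
      continuous_on_psd N,
      forall (t : R) A, 0 <= t -> psdmx A -> N (cR t *: A) = t * N A,
      forall U A, U \is unitarymx -> psdmx A -> N (U *m A *m adj U) = N A &
      forall A B, psdmx A -> psdmx B -> N A + N B <= N (A + B)].

Definition jointly_concave {n m} (g : 'M[C]_n -> 'M[C]_m -> R) : Prop :=
  forall A1 A2 B1 B2 (t : R), pdmx A1 -> pdmx A2 -> pdmx B1 -> pdmx B2 ->
    0 <= t <= 1 ->
    t * g A1 B1 + (1 - t) * g A2 B2
      <= g (cR t *: A1 + cR (1 - t) *: A2) (cR t *: B1 + cR (1 - t) *: B2).
Definition jointly_convex {n m} (g : 'M[C]_n -> 'M[C]_m -> R) : Prop :=
  forall A1 A2 B1 B2 (t : R), pdmx A1 -> pdmx A2 -> pdmx B1 -> pdmx B2 ->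
    0 <= t <= 1 ->
    g (cR t *: A1 + cR (1 - t) *: A2) (cR t *: B1 + cR (1 - t) *: B2)
      <= t * g A1 B1 + (1 - t) * g A2 B2.

Definition nondecr_pos (f : R -> R) : Prop :=
  forall x y, 0 < x -> x <= y -> f x <= f y.
Definition concave_pos (f : R -> R) : Prop :=
  forall x y t, 0 < x -> 0 < y -> 0 <= t <= 1 ->
    t * f x + (1 - t) * f y <= f (t * x + (1 - t) * y).
Definition convex_pos (f : R -> R) : Prop :=
  forall x y t, 0 < x -> 0 < y -> 0 <= t <= 1 ->
    f (t * x + (1 - t) * y) <= t * f x + (1 - t) * f y.

(* the trace Tr f(X) (real since f(X) is Hermitian) *)
Definition trf {p} (f : R -> R) (X : 'M[C]_p) : R := complex.Re (\tr (mxfun f X)).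

End Defs.

(* Main.v *)
Require Import Defs.
From HB Require Import structures.
From mathcomp Require Import all_boot all_order all_algebra.
From mathcomp Require Import perm classical_sets reals complex.
From mathcomp Require Import lra ring zify.
Set Implicit Arguments.
Unset Strict Implicit.
Unset Printing Implicit Defensive.
Import Order.TTheory GRing.Theory Num.Theory.
Local Open Scope ring_scope.
Local Open Scope sesquilinear_scope.

(**
Everything reduces to eigenvalue vectors.  Write [X] for the value of [F] at a
convex combination and [Y1], [Y2] for its values at the end points.  Condition
(a)' says that the increasing eigenvalues of [X] weakly supermajorize
[t * y1 + (1 - t) * y2], where [y1] and [y2] are the increasing eigenvalues of
[Y1] and [Y2].  T-transforms then produce a vector below the eigenvalues of [X]
that is obtained from [t * y1 + (1 - t) * y2] by averaging over transpositions;
hence every symmetric, monotone, concave function of the eigenvalues increases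
from the latter to the former.  Applied to [N (diag u)], to [\sum f (u i)] and to
[- \sum_(i < k) (u i)^-1] this gives (a), (c) and (b)'; applied to the negated
decreasing eigenvalues of the inverses, (b)' gives (b) and (d).  Conversely, Ky
Fan's variational principle makes the Ky Fan functionals symmetric anti-norms,
respectively restrictions of symmetric norms.  Finally (c) gives (d) because
[u |-> - f u^-1] is non-decreasing and concave when [f] is non-decreasing and
convex.
*)

(** * Weak supermajorization and T-transforms *)

Section Majorization.
Variables (R : realFieldType) (n : nat).
Implicit Types (x z w : 'I_n -> R).

(* A T-transform moving mass [min (x j - z j) (z k - x k)] from k to j keeps
   all the prefix sums below those of [x] and makes [z] agree with [x] at one
   more index. Only [x] has to be sorted. *)
Lemma weak_supermajorization_ind (P : ('I_n -> R) -> Prop) x z :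
  (forall w i j (t : R), P w -> 0 <= t <= 1 ->
     P (fun a => t * w a + (1 - t) * w (tperm i j a))) ->
  {homo x : i j / (i <= j)%N >-> i <= j} ->
  (forall k, (k <= n)%N ->
     \sum_(i < n | (i < k)%N) z i <= \sum_(i < n | (i < k)%N) x i) ->
  P z -> exists2 w, P w & forall i, w i <= x i.
Proof.
move=> PT x_incr.
(* The induction is on the number of indices at which [z] and [x] differ. *)
have [d] := ubnP #|[pred i | z i != x i]|.
elim: d z => // d IHd z le_d z_le_x Pz.
have [/forallP z_le|] := boolP [forall i, z i <= x i]; first by exists z.
rewrite negb_forall => /existsP[k0]; rewrite -ltNge => lt_k0.
(* [k] is the first index at which [z] exceeds [x]. *)
case: (@arg_minnP _ k0 [pred i | x i < z i] (@nat_of_ord n)) => //= k lt_k k_min.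
have z_le_before (i : 'I_n) : (i < k)%N -> z i <= x i.
  by move=> lt_ik; rewrite leNgt; apply/negP => /k_min; rewrite leqNgt lt_ik.
(* Without room at some earlier index [j], the prefix sum up to and including [k] would be larger
   for [z] than for [x]. *)
have [j lt_jk lt_j] : exists2 j : 'I_n, (j < k)%N & z j < x j.
  have [/existsP[j /andP[]]|] := boolP [exists j : 'I_n, (j < k)%N && (z j < x j)].
    by exists j.
  rewrite negb_exists => /forallP z_ge; exfalso.
  have := z_le_x _ (ltn_ord k); rewrite leNgt => /negP; apply.
  rewrite [ltLHS](bigD1 k) //= [ltRHS](bigD1 k) //=; apply: ltr_leD => //.
  apply: ler_sum => i /andP[]; rewrite ltnS leq_eqVlt => /orP[/eqP /val_inj-> /eqP//|].
  by move=> lt_ik _; have := z_ge i; rewrite lt_ik -leNgt.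
have ne_jk : j != k by rewrite -val_eqE /= ltn_eqF.
(* Sortedness enters here: [z j < x j <= x k < z k], so [delta] is less than the gap [z k - z j]. *)
have le_xjk : x j <= x k by apply: x_incr; exact: ltnW.
pose delta := Num.min (x j - z j) (z k - x k).
have delta_gt0 : 0 < delta by rewrite lt_min !subr_gt0 lt_j.
have delta_lej : delta <= x j - z j by rewrite ge_min lexx.
have delta_lek : delta <= z k - x k by rewrite ge_min lexx orbT.
(* Chosen so that averaging with the transposed vector moves exactly [delta] from [k] to [j]. *)
pose t := 1 - delta / (z k - z j).
have gap : 0 < z k - z j by lra.
have t01 : 0 <= t <= 1.
  have le1 : delta / (z k - z j) <= 1 by rewrite ler_pdivrMr ?mul1r; lra.
  have ge0 : 0 <= delta / (z k - z j) by rewrite divr_ge0 // ltW.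
  by rewrite /t; lra.
pose z' a := t * z a + (1 - t) * z (tperm j k a).
have tE : (1 - t) * (z k - z j) = delta.
  by rewrite /t subKr divfK // gt_eqF.
have z'j : z' j = z j + delta by rewrite -tE /z' tpermL; ring.
have z'k : z' k = z k - delta by rewrite -tE /z' tpermR; ring.
have z'E a : a != j -> a != k -> z' a = z a.
  by move=> ne_aj ne_ak; rewrite /z' tpermD 1?eq_sym //; ring.
(* Indices of agreement are kept, and one of [j], [k] joins them, according to which term attains
   the minimum in [delta]. *)
apply: (IHd z'); last exact: PT.
  rewrite -ltnS; apply: leq_trans le_d; rewrite ltnS; apply: proper_card.
  apply/properP; split.
    apply/fintype.subsetP => a; rewrite !inE => ne_a.
    have [->|ne_aj] := eqVneq a j; first by rewrite lt_eqF.
    have [->|ne_ak] := eqVneq a k; first by rewrite gt_eqF.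
    by rewrite -(z'E a).
  have [le_d1|lt_d2] := leP (x j - z j) (z k - x k).
    exists j; rewrite !inE; first by rewrite lt_eqF.
    by rewrite z'j /delta (min_idPl le_d1) addrC subrK eqxx.
  exists k; rewrite !inE; first by rewrite gt_eqF.
  by rewrite z'k /delta (min_idPr (ltW lt_d2)) subKr eqxx.
move=> q le_qn.
(* A prefix containing [k] also contains [j], so its sum is unchanged. A prefix ending before [k] is
   bounded term by term, since [delta <= x j - z j]. *)
have [lt_kq|le_qk] := ltnP k q.
  apply: le_trans (z_le_x q le_qn).
  rewrite (bigD1 k) //= (bigD1 j) ?(ltn_trans lt_jk) //=.
  rewrite [leRHS](bigD1 k) //= [X in _ <= _ + X](bigD1 j) ?(ltn_trans lt_jk) //=.
  rewrite z'j z'k (eq_bigr z); first by lra.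
  by move=> i /andP[/andP[_ ?] ?]; rewrite z'E.
have lt_before (i : 'I_n) : (i < q)%N -> (i < k)%N by move=> ?; apply: leq_trans le_qk.
have ne_before (i : 'I_n) : (i < q)%N -> i != k.
  by move=> /lt_before; rewrite -val_eqE => /ltn_eqF->.
apply: ler_sum => i /[dup] /lt_before /z_le_before le_i /ne_before ne_ik.
by have [->|?] := eqVneq i j; [rewrite z'j; lra | rewrite z'E].
Qed.

End Majorization.

(** * Majorization inequalities for sums *)

Section SumInequalities.
Variables (R : realFieldType) (n : nat).
Implicit Types (x z : 'I_n -> R).

(** A T-transform does not decrease the sum: concavity applies termwise, and reindexing by the
    transposition gives back the old sum. Monotonicity covers the last passage from [w] to [x]. The
    convex domain [D] is carried along because [f] is controlled only there. *)
Lemma sum_concave_supermajorization (D : R -> Prop) (f : R -> R) x z :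
  (forall u v t : R, D u -> D v -> 0 <= t <= 1 -> D (t * u + (1 - t) * v)) ->
  (forall u v : R, D u -> D v -> u <= v -> f u <= f v) ->
  (forall u v t : R, D u -> D v -> 0 <= t <= 1 ->
     t * f u + (1 - t) * f v <= f (t * u + (1 - t) * v)) ->
  {homo x : i j / (i <= j)%N >-> i <= j} ->
  (forall k, (k <= n)%N ->
     \sum_(i < n | (i < k)%N) z i <= \sum_(i < n | (i < k)%N) x i) ->
  (forall i, D (x i)) -> (forall i, D (z i)) ->
  \sum_i f (z i) <= \sum_i f (x i).
Proof.
move=> Dconv f_incr f_conc x_incr z_le_x Dx Dz.
pose P (w : 'I_n -> R) := (forall i, D (w i)) /\ \sum_i f (z i) <= \sum_i f (w i).
have [w [Dw le_w] le_wx] : exists2 w, P w & forall i, w i <= x i.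
  apply: (@weak_supermajorization_ind _ _ P x z) => //.
  move=> w i j t [Dw le_w] t01; split=> [a|]; first exact: Dconv.
  apply: (le_trans le_w).
  have -> : \sum_a f (w a) =
      \sum_a (t * f (w a) + (1 - t) * f (w (tperm i j a))).
    rewrite big_split /= -!mulr_sumr.
    rewrite -(reindex_inj (@perm_inj _ (tperm i j)) (P := predT)
      (F := fun a => f (w a))) /=.
    by ring.
  by apply: ler_sum => a _; exact: f_conc.
by apply: (le_trans le_w); apply: ler_sum => i _; exact: f_incr.
Qed.

(** Reflection [u |-> - f (- u)] turns convex into concave, keeps monotonicity, and makes the
    negated vector increasing. *)
Lemma sum_convex_submajorization (D : R -> Prop) (f : R -> R) x z :
  (forall u v t : R, D u -> D v -> 0 <= t <= 1 -> D (t * u + (1 - t) * v)) ->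
  (forall u v : R, D u -> D v -> u <= v -> f u <= f v) ->
  (forall u v t : R, D u -> D v -> 0 <= t <= 1 ->
     f (t * u + (1 - t) * v) <= t * f u + (1 - t) * f v) ->
  {homo x : i j / (i <= j)%N >-> j <= i} ->
  (forall k, (k <= n)%N ->
     \sum_(i < n | (i < k)%N) x i <= \sum_(i < n | (i < k)%N) z i) ->
  (forall i, D (x i)) -> (forall i, D (z i)) ->
  \sum_i f (x i) <= \sum_i f (z i).
Proof.
move=> Dconv f_incr f_conv x_decr x_le_z Dx Dz.
have combN (u v t : R) : - (t * u + (1 - t) * v) = t * - u + (1 - t) * - v.
  by ring.
have := @sum_concave_supermajorization (fun u => D (- u)) (fun u => - f (- u))
  (fun i => - x i) (fun i => - z i).
under eq_bigr do rewrite opprK; under [X in _ <= X]eq_bigr do rewrite opprK.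
rewrite !sumrN lerN2; apply.
- by move=> u v t Du Dv t01; rewrite combN; exact: Dconv.
- by move=> u v Du Dv le_uv; rewrite lerN2; apply: f_incr; rewrite // lerN2.
- by move=> u v t Du Dv t01; rewrite -[leLHS]combN lerN2 combN; exact: f_conv.
- by move=> i j le_ij; rewrite lerN2; exact: x_decr.
- by move=> k le_kn; rewrite !sumrN lerN2; exact: x_le_z.
- by move=> i; rewrite opprK.
- by move=> i; rewrite opprK.
Qed.

(** Let [th] separate the first [k] values of [d] from the others. Since the weights sum to [k],
    subtracting [th] from every [d i] does not affect the difference of the two sides, and then each
    term is a product of two factors of equal sign. *)
Lemma sum_prefix_le_weighted (d c : 'I_n -> R) (k : nat) :
  {homo d : i j / (i <= j)%N >-> i <= j} -> (k <= n)%N ->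
  (forall i, 0 <= c i <= 1) -> \sum_i c i = k%:R ->
  \sum_(i < n | (i < k)%N) d i <= \sum_i c i * d i.
Proof.
move=> d_incr le_kn c01 sum_c.
(* For [k < n] the threshold is [d] at index [k]; for [k = n] any upper bound of [d] serves, here
   the sum of absolute values. *)
have [th [lo hi]] : exists th, (forall i : 'I_n, (i < k)%N -> d i <= th) /\
    (forall i : 'I_n, (k <= i)%N -> th <= d i).
  have [lt_kn|le_nk] := ltnP k n.
    by exists (d (Ordinal lt_kn)); split=> i le_i; apply: d_incr; rewrite //= ltnW.
  exists (\sum_i `|d i|); split=> i le_i.
    apply: (le_trans (ler_norm _)); rewrite (bigD1 i) //= lerDl.
    by apply: sumr_ge0.
  by have := leq_trans le_nk le_i; rewrite leqNgt ltn_ord.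
rewrite -subr_ge0 [X in _ - X]big_mkcond /= -sumrB.
have card_k : \sum_(i < n) ((i < k)%N%:R : R) = k%:R.
  transitivity (\sum_(i < n | (i < k)%N) (1 : R)).
    by rewrite [RHS]big_mkcond; apply: eq_bigr => i _; case: ifP.
  by rewrite -(big_ord_widen n (fun=> 1 : R)) // sumr_const card_ord.
have -> : \sum_i (c i * d i - (if (i < k)%N then d i else 0)) =
    \sum_i (c i - (i < k)%N%:R) * (d i - th).
  rewrite [RHS](eq_bigr (fun i : 'I_n => (c i * d i - (if (i < k)%N then d i else 0)) -
     (c i - (i < k)%N%:R) * th)); last first.
    by move=> i _; case: (i < k)%N => /=; ring.
  rewrite [RHS]sumrB -mulr_suml [X in _ - X * th]sumrB sum_c card_k subrr mul0r.
  by rewrite subr0.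
apply: sumr_ge0 => i _; have /andP[c0 c1] := c01 i.
have [lt_ik|le_ki] := ltnP i k.
  by apply: mulr_le0; rewrite subr_le0 // lo.
by apply: mulr_ge0; rewrite ?subr0 // subr_ge0 hi.
Qed.

End SumInequalities.

(** * Real parts and moduli of complex scalars *)

Section ComplexEntries.
Variable R : realType.
Local Notation C := R[i].
Implicit Types (a b : C).

Lemma ReD a b : complex.Re (a + b) = complex.Re a + complex.Re b.
Proof. by case: a b => [? ?] [? ?]. Qed.

Lemma ReN a : complex.Re (- a) = - complex.Re a.
Proof. by case: a. Qed.

Lemma Re_sum (I : finType) (P : pred I) (F : I -> C) :
  complex.Re (\sum_(i | P i) F i) = \sum_(i | P i) complex.Re (F i).
Proof. by apply: (big_morph (@complex.Re R) ReD). Qed.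

Lemma Re_cRM (x : R) a : complex.Re (cR x * a) = x * complex.Re a.
Proof. by case: a => a1 a2 /=; rewrite mul0r subr0. Qed.

Lemma cRM (x y : R) : cR (x * y) = cR x * cR y.
Proof. exact: (rmorphM (real_complex R)). Qed.

Lemma cRD (x y : R) : cR (x + y) = cR x + cR y.
Proof. exact: (rmorphD (real_complex R)). Qed.

Lemma cR_ge0 (x : R) : (0 <= cR x) = (0 <= x).
Proof. exact: ler0c. Qed.

Lemma cR_inj : injective (@cR R).
Proof. exact: (@complexI R). Qed.

Lemma ler_cR (x y : R) : (cR x <= cR y) = (x <= y).
Proof. exact: lecR. Qed.

Lemma conj_cR (x : R) : (cR x)^* = cR x.
Proof. by apply/CrealP; rewrite complex_real. Qed.

Lemma normE a : `|a| = cR (cabs a).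
Proof. by rewrite /cabs normc_def. Qed.

Lemma cabs_ge0 a : 0 <= cabs a.
Proof. by rewrite -cR_ge0 -normE. Qed.

Lemma cabsM a b : cabs (a * b) = cabs a * cabs b.
Proof. by apply: cR_inj; rewrite cRM -!normE normrM. Qed.

Lemma cabsD a b : cabs (a + b) <= cabs a + cabs b.
Proof. by rewrite -ler_cR cRD -!normE ler_normD. Qed.

Lemma cabs_sum (I : finType) (P : pred I) (F : I -> C) :
  cabs (\sum_(i | P i) F i) <= \sum_(i | P i) cabs (F i).
Proof.
elim/big_rec2: _ => [|i x y _ le_xy]; first by rewrite /cabs normr0.
by apply: (le_trans (cabsD _ _)); rewrite lerD2l.
Qed.

Lemma cabs_eq0 a : cabs a = 0 -> a = 0.
Proof. by move=> a0; apply/eqP; rewrite -normr_eq0 normE a0. Qed.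

Lemma cabs_conj a : cabs a^* = cabs a.
Proof. by rewrite /cabs norm_conjC. Qed.

Lemma cabs_cR (x : R) : 0 <= x -> cabs (cR x) = x.
Proof. by move=> x0; apply: cR_inj; rewrite -normE ger0_norm ?cR_ge0. Qed.

Lemma Re_le_cabs a : complex.Re a <= cabs a.
Proof.
rewrite -ler_cR -normE; apply: le_trans (normc_ge_Re a).
by rewrite -[leRHS]/(cR _) ler_cR ler_norm.
Qed.

Lemma mul_conj_cabs a : a * a^* = cR (cabs a ^+ 2).
Proof. by rewrite -normCK normE expr2 -cRM -expr2. Qed.

Lemma Re_ge0 a : 0 <= a -> 0 <= complex.Re a.
Proof. by rewrite lecE => /andP[]. Qed.

Lemma Re_gt0 a : 0 < a -> 0 < complex.Re a.
Proof. by rewrite ltcE => /andP[]. Qed.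

End ComplexEntries.

(** * Unitary diagonalization of Hermitian matrices *)

Section Diagonalization.
Variables (R : realType) (p : nat).
Local Notation C := R[i].
Implicit Types (A B U V W X : 'M[C]_p) (d e : 'I_p -> R).

Lemma adjM m n q (A : 'M[C]_(m, n)) (B : 'M[C]_(n, q)) :
  adj (A *m B) = adj B *m adj A.
Proof. by rewrite /adj trmx_mul map_mxM. Qed.

Lemma adjK m n (A : 'M[C]_(m, n)) : adj (adj A) = A.
Proof. exact: trmxCK. Qed.

Lemma adjD m n (A B : 'M[C]_(m, n)) : adj (A + B) = adj A + adj B.
Proof. by apply/matrixP => i j; rewrite !mxE rmorphD. Qed.

Lemma adj_cRZ m n (t : R) (A : 'M[C]_(m, n)) : adj (cR t *: A) = cR t *: adj A.
Proof. by apply/matrixP => i j; rewrite !mxE rmorphM /= conj_cR. Qed.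

Lemma unitary_mul_adj U : U \is unitarymx -> U *m adj U = 1%:M.
Proof. by move/unitarymxP. Qed.

Lemma unitary_adj_mul U : U \is unitarymx -> adj U *m U = 1%:M.
Proof. by move=> /unitary_mul_adj; exact: mulmx1C. Qed.

Lemma unitary_adj U : U \is unitarymx -> adj U \is unitarymx.
Proof. by rewrite /adj trmxC_unitary. Qed.

Lemma perm_mx_unitary (s : 'S_p) : perm_mx s \is @unitarymx C p p.
Proof.
apply/unitarymxP; have -> : (perm_mx s : 'M[C]_p)^t* = perm_mx s^-1.
  by rewrite tr_perm_mx map_perm_mx.
by rewrite -perm_mxM mulgV perm_mx1.
Qed.

Definition diagR d : 'M[C]_p := diag_mx (\row_i cR (d i)).

Lemma diagRE d i j : diagR d i j = if i == j then cR (d i) else 0.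
Proof. by rewrite !mxE; case: eqP => [->|]. Qed.

Lemma adj_diagR d : adj (diagR d) = diagR d.
Proof.
apply/matrixP => i j; rewrite mxE mxE !diagRE eq_sym.
by case: eqP => [->|_]; rewrite ?conj_cR ?rmorph0.
Qed.

Lemma eq_diagR d e : d =1 e -> diagR d = diagR e.
Proof. by move=> de; apply/matrixP => i j; rewrite !diagRE de. Qed.

Lemma diagR_comb (t u : R) d e :
  diagR (fun i => t * d i + u * e i) = cR t *: diagR d + cR u *: diagR e.
Proof.
apply/matrixP => i j; rewrite !mxE.
by case: eqP => _; rewrite ?mulr0n ?mulr1n ?mulr0 ?addr0 // cRD !cRM.
Qed.

Lemma perm_diagR d (s : 'S_p) :
  perm_mx s *m diagR d *m adj (perm_mx s) = diagR (fun i => d (s i)).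
Proof.
rewrite /adj tr_perm_mx map_perm_mx -row_permE -col_permE.
by apply/matrixP => i j; rewrite mxE mxE !diagRE (inj_eq perm_inj).
Qed.

(** The entries of [d] come in no fixed order, so one relation serves the spectral theorem, both
    sorted orders and diagonal matrices. The columns of [adj W] are the eigenvectors. *)
Definition diagonalizes W d A :=
  W \is unitarymx /\ A = adj W *m diagR d *m W.

Lemma diagonalizes_conj W d A :
  diagonalizes W d A -> W *m A *m adj W = diagR d.
Proof.
case=> W_unit ->; rewrite !mulmxA unitary_mul_adj // mul1mx -mulmxA.
by rewrite unitary_mul_adj // mulmx1.
Qed.

Lemma diagonalizes_herm W d A : diagonalizes W d A -> adj A = A.
Proof. by case=> _ ->; rewrite !adjM adjK adj_diagR mulmxA. Qed.

Lemma diagonalizes_diagR d : diagonalizes 1%:M d (diagR d).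
Proof.
have adj1 : adj (1%:M : 'M[C]_p) = 1%:M by rewrite /adj trmx1 map_mx1.
by split; [apply/unitarymxP; rewrite -/(adj _) adj1 mulmx1 | rewrite adj1 mul1mx mulmx1].
Qed.

Lemma diagonalizes_perm W d A (s : 'S_p) :
  diagonalizes W d A -> diagonalizes (perm_mx s *m W) (fun i => d (s i)) A.
Proof.
have s_unit := perm_mx_unitary s.
case=> W_unit ->; split; first exact: (mul_unitarymx s_unit W_unit).
rewrite -perm_diagR adjM !mulmxA -(mulmxA (adj W) (adj (perm_mx s))).
rewrite (unitary_adj_mul s_unit) mulmx1.
by rewrite -(mulmxA _ (adj (perm_mx s))) (unitary_adj_mul s_unit) mulmx1.
Qed.

(** The spectral theorem for normal matrices; Hermitian symmetry makes the eigenvalues real, so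
    keeping only their real parts loses nothing. *)
Lemma hermitian_diagonalizes A : adj A = A ->
  diagonalizes (spectralmx A) (fun i => complex.Re (spectral_diag A 0 i)) A.
Proof.
move=> A_herm; have A_hermsym : A \is hermsymmx.
  by apply/is_hermitianmxP; rewrite expr0 scale1r -/(adj A) A_herm.
split; first exact: spectral_unitarymx.
have /orthomx_spectralP {1}-> := hermitian_normalmx A_hermsym.
rewrite (invmx_unitary (spectral_unitarymx A)) -/(adj _).
suff -> : diag_mx (spectral_diag A) =
  diagR (fun i => complex.Re (spectral_diag A 0 i)) by [].
apply/matrixP => i j; rewrite diagRE mxE; case: eqP => // _; rewrite mulr1n.
have /mxOverP/(_ 0 i) := hermitian_spectral_diag_real A_hermsym.
by move=> /RRe_real <-.
Qed.

(** * Sorted eigenvalues *)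

Lemma size_eigs A : size (eigs A) = p.
Proof. by rewrite size_sort size_map size_enum_ord. Qed.

Lemma eigval_perm A : exists s : 'S_p, forall i : 'I_p,
  eigval A i.+1 = complex.Re (spectral_diag A 0 (s i)).
Proof.
have /tuple_permP[s Es] : perm_eq (eigs A)
    [tuple complex.Re (spectral_diag A 0 i) | i < p].
  by rewrite /= perm_sort.
by exists s => i; rewrite /eigval Es /= nth_mktuple tnth_mktuple.
Qed.

(** The bound [j < p] keeps both positions inside the list, whose default value 0 could exceed a
    negative eigenvalue. *)
Lemma eigval_decr A i j : (i <= j < p)%N -> eigval A j.+1 <= eigval A i.+1.
Proof.
move=> /andP[le_ij lt_jp]; rewrite /eigval.
have le_trans_rev : transitive (fun x y : R => y <= x).
  by move=> y x z le_yx le_zy; exact: le_trans le_zy le_yx.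
have le_total_rev : total (fun x y : R => y <= x) by move=> x y; exact: le_total.
apply: (sorted_leq_nth le_trans_rev (@lexx _ R) 0 (sort_sorted le_total_rev _)) => //.
  by rewrite inE size_eigs (leq_ltn_trans le_ij).
by rewrite inE size_eigs.
Qed.

(** [eigval] counts from 1 at the largest eigenvalue, so [p - i] for [i = 0, ..., p - 1] reads the
    spectrum from the smallest one up. *)
Lemma eigval_incr A :
  {homo (fun i : 'I_p => eigval A (p - i)) : i j / (i <= j)%N >-> i <= j}.
Proof.
move=> i j le_ij; have := ltn_ord i; have := ltn_ord j => lt_jp lt_ip.
rewrite -(subnSK lt_jp) -(subnSK lt_ip); apply: eigval_decr; lia.
Qed.

Lemma diagonalizes_eigval_decr A : adj A = A ->
  exists W, diagonalizes W (fun i => eigval A i.+1) A.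
Proof.
move=> /hermitian_diagonalizes dA; have [s Es] := eigval_perm A.
exists (perm_mx s *m spectralmx A).
have [W_unit AE] := diagonalizes_perm s dA; split; first exact: W_unit.
by rewrite (eq_diagR Es) -AE.
Qed.

Lemma diagonalizes_eigval_incr A : adj A = A ->
  exists W, diagonalizes W (fun i : 'I_p => eigval A (p - i)) A.
Proof.
move=> /diagonalizes_eigval_decr[W dA].
exists (perm_mx (perm (@rev_ord_inj p)) *m W).
have [W_unit AE] := diagonalizes_perm (perm (@rev_ord_inj p)) dA.
split; first exact: W_unit.
rewrite [LHS]AE; congr (_ *m _ *m _); apply: eq_diagR => i.
by rewrite permE /= subnSK.
Qed.

(** * Ky Fan's variational principle and uniqueness of the spectrum *)

Lemma diag_entry_conj V d i :
  complex.Re ((V *m diagR d *m adj V) i i) = \sum_j cabs (V i j) ^+ 2 * d j.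
Proof.
rewrite mxE Re_sum; apply: eq_bigr => j _.
rewrite mul_mx_diag !mxE mulrAC mul_conj_cabs mulrC Re_cRM mulrC /=.
by [].
Qed.

Lemma unitary_row_sum V i : V \is unitarymx -> \sum_j cabs (V i j) ^+ 2 = 1.
Proof.
move=> /unitary_mul_adj /matrixP/(_ i i); rewrite !mxE eqxx => /(congr1 (@complex.Re R)).
rewrite Re_sum mulr1n /= => <-; apply: eq_bigr => j _.
by rewrite !mxE mul_conj_cabs.
Qed.

Lemma unitary_col_sum V j : V \is unitarymx -> \sum_i cabs (V i j) ^+ 2 = 1.
Proof.
move=> /unitary_adj V_unit; rewrite -(unitary_row_sum j V_unit); apply: eq_bigr => i _.
by rewrite !mxE cabs_conj.
Qed.

(** With [V = U *m adj W], the diagonal entries sum to a combination of the [d j], weighted by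
    partial column sums of the doubly stochastic matrix [cabs (V i j) ^+ 2]. Full column sums bound
    the weights by 1, and row sums make their total [k]. *)
Lemma ky_fan_min W d A U k : diagonalizes W d A -> U \is unitarymx ->
  {homo d : i j / (i <= j)%N >-> i <= j} -> (k <= p)%N ->
  \sum_(i < p | (i < k)%N) d i
    <= \sum_(i < p | (i < k)%N) complex.Re ((U *m A *m adj U) i i).
Proof.
move=> [W_unit ->] U_unit d_incr le_kp.
pose V := U *m adj W.
have V_unit : V \is unitarymx := mul_unitarymx U_unit (unitary_adj W_unit).
have -> : U *m (adj W *m diagR d *m W) *m adj U = V *m diagR d *m adj V.
  by rewrite /V adjM adjK !mulmxA.
under [leRHS]eq_bigr do rewrite diag_entry_conj.
rewrite exchange_big /=; under [leRHS]eq_bigr do rewrite -mulr_suml.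
apply: sum_prefix_le_weighted => // [j|].
  apply/andP; split; first by apply: sumr_ge0 => i _; rewrite sqr_ge0.
  rewrite -(unitary_col_sum j V_unit) [leLHS]big_mkcond.
  by apply: ler_sum => i _; case: ifP; rewrite // sqr_ge0.
rewrite exchange_big /=.
under eq_bigr do rewrite unitary_row_sum //.
by rewrite -(big_ord_widen p (fun=> 1 : R)) // sumr_const card_ord.
Qed.

Lemma diagonalizesN W d A :
  diagonalizes W d A -> diagonalizes W (fun i => - d i) (- A).
Proof.
case=> W_unit ->; split; first exact: W_unit.
rewrite -mulNmx -mulmxN; congr (_ *m _ *m _).
apply/matrixP => i j; rewrite mxE !diagRE; case: eqP => _; last by rewrite oppr0.
by apply/eqP; rewrite eq_complex /= oppr0 !eqxx.
Qed.

Lemma ky_fan_max W d A U k : diagonalizes W d A -> U \is unitarymx ->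
  {homo d : i j / (i <= j)%N >-> j <= i} -> (k <= p)%N ->
  \sum_(i < p | (i < k)%N) complex.Re ((U *m A *m adj U) i i)
    <= \sum_(i < p | (i < k)%N) d i.
Proof.
move=> /diagonalizesN dA U_unit d_decr le_kp.
have dN_incr : {homo (fun i => - d i) : i j / (i <= j)%N >-> i <= j}.
  by move=> i j /d_decr; rewrite lerN2.
have := ky_fan_min dA U_unit dN_incr le_kp.
by rewrite mulmxN mulNmx -lerN2 -!sumrN; under eq_bigr do rewrite mxE ReN opprK;
   under [X in _ <= X]eq_bigr do rewrite opprK.
Qed.

(** By Ky Fan's principle each prefix sum of a decreasing spectrum dominates that of any other
    diagonalization, so two decreasing ones have equal prefix sums. This lets [eigval] be read off
    from any sorted diagonalization. *)
Lemma diagonalizes_uniq W V d e A : diagonalizes W d A -> diagonalizes V e A ->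
  {homo d : i j / (i <= j)%N >-> j <= i} ->
  {homo e : i j / (i <= j)%N >-> j <= i} -> d =1 e.
Proof.
suff le W' V' d' e' k : diagonalizes W' d' A -> diagonalizes V' e' A ->
    {homo d' : i j / (i <= j)%N >-> j <= i} -> (k <= p)%N ->
    \sum_(i < p | (i < k)%N) e' i <= \sum_(i < p | (i < k)%N) d' i.
  move=> dA eA d_decr e_decr i.
  have eq_k k : (k <= p)%N ->
      \sum_(i < p | (i < k)%N) d i = \sum_(i < p | (i < k)%N) e i.
    move=> le_kp; apply/eqP; rewrite eq_le; apply/andP.
    by split; [apply: (le V W) | apply: (le W V)].
  (* Consecutive prefix sums differ by the single term at [i]. *)
  have := eq_k i.+1 (ltn_ord i); rewrite (bigD1 i) //= [RHS](bigD1 i) //=.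
  have restE (g : 'I_p -> R) : \sum_(j < p | (j < i.+1)%N && (j != i)) g j =
      \sum_(j < p | (j < i)%N) g j.
    by apply: eq_bigl => j; rewrite -val_eqE /=; lia.
  by rewrite !restE eq_k ?(ltnW (ltn_ord i)) // => /addIr.
move=> dA eA d_decr le_kp.
have := ky_fan_max dA eA.1 d_decr le_kp; rewrite (diagonalizes_conj eA).
by under eq_bigr do rewrite diagRE eqxx.
Qed.

Lemma eigvalE W d A (i : 'I_p) : diagonalizes W d A ->
  {homo d : i j / (i <= j)%N >-> j <= i} -> eigval A i.+1 = d i.
Proof.
move=> dA d_decr.
have [V eA] := diagonalizes_eigval_decr (diagonalizes_herm dA).
apply: (diagonalizes_uniq eA dA) => // j k le_jk.
by apply: eigval_decr; rewrite le_jk ltn_ord.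
Qed.

(** * Spectra of inverses and of positive matrices *)

Lemma diagonalizes_inv W d A : diagonalizes W d A -> (forall i, d i != 0) ->
  diagonalizes W (fun i => (d i)^-1) (invmx A).
Proof.
case=> W_unit AE d_neq0; split; first exact: W_unit.
set B := adj W *m _ *m W.
have AB1 : A *m B = 1%:M.
  rewrite AE /B !mulmxA -(mulmxA _ W) unitary_mul_adj // mulmx1.
  rewrite -(mulmxA (adj W)) (_ : diagR d *m _ = 1%:M) ?mulmx1 ?unitary_adj_mul //.
  apply/matrixP => i j; rewrite mul_diag_mx mxE [X in _ * X]diagRE !mxE.
  by case: eqP => _; rewrite ?mulr0 // -cRM mulfV.
have A_unit : A \in unitmx by case: (mulmx1_unit AB1).
by rewrite -[LHS]mulmx1 -AB1 mulKmx.
Qed.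

Lemma diag_entry_form V A i :
  (V *m A *m adj V) i i = (adj (col i (adj V)) *m A *m col i (adj V)) 0 0.
Proof.
have -> : adj (col i (adj V)) = row i V.
  by apply/matrixP => a b; rewrite !mxE conjCK.
by rewrite -row_mul !mxE; apply: eq_bigr => j _; rewrite !mxE.
Qed.

Lemma diagonalizes_entry W d A i : diagonalizes W d A ->
  cR (d i) = (adj (col i (adj W)) *m A *m col i (adj W)) 0 0.
Proof.
by move=> dA; rewrite -diag_entry_form (diagonalizes_conj dA) diagRE eqxx.
Qed.

(** [d i] is the quadratic form at column [i] of [adj W], which is nonzero because row [i] of the
    unitary [W] has norm 1. *)
Lemma diagonalizes_pd_gt0 W d A i :
  diagonalizes W d A -> pdmx A -> 0 < d i.
Proof.
move=> dA [_ A_gt0]; suff : 0 < cR (d i) by move/Re_gt0.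
rewrite (diagonalizes_entry i dA) A_gt0 //; apply/eqP => col0.
have /matrixP/(_ i i) := unitary_mul_adj dA.1; rewrite !mxE eqxx.
rewrite big1 => [/eqP|j _]; first by rewrite eq_sym oner_eq0.
by move/matrixP/(_ j 0): col0; rewrite !mxE => ->; rewrite mulr0.
Qed.

Lemma eigval_gt0 A i : pdmx A -> (0 < i <= p)%N -> 0 < eigval A i.
Proof.
move=> A_pd; have [W dA] := diagonalizes_eigval_decr A_pd.1.
case: i => // i lt_ip; exact: (diagonalizes_pd_gt0 (Ordinal lt_ip) dA A_pd).
Qed.

(** Inversion reverses the order of positive numbers, so an increasing diagonalization of [A] gives
    a decreasing one of its inverse. *)
Lemma eigval_inv A (i : 'I_p) : pdmx A ->
  eigval (invmx A) i.+1 = (eigval A (p - i))^-1.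
Proof.
move=> A_pd; have [W dA] := diagonalizes_eigval_incr A_pd.1.
have d_gt0 j := diagonalizes_pd_gt0 j dA A_pd.
have dAinv := diagonalizes_inv dA (fun j => lt0r_neq0 (d_gt0 j)).
rewrite (eigvalE i dAinv) // => j k le_jk.
by rewrite lef_pV2 ?posrE ?d_gt0 //; exact: eigval_incr.
Qed.

Lemma diagonalizes_psd W d A :
  diagonalizes W d A -> (forall i, 0 <= d i) -> psdmx A.
Proof.
move=> dA d_ge0; split=> [|v]; first exact: diagonalizes_herm dA.
rewrite dA.2; have -> : adj v *m (adj W *m diagR d *m W) *m v =
    adj (W *m v) *m diagR d *m (W *m v) by rewrite adjM !mulmxA.
move: (W *m v) => u; rewrite mxE sumr_ge0 // => i _; rewrite mul_mx_diag !mxE.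
by rewrite mulrAC (mulrC (_^*)) mul_conj_cabs -cRM cR_ge0 mulr_ge0 ?sqr_ge0.
Qed.

(** * Ky Fan functionals and traces as sums over the spectrum *)

Lemma kyfan_normE k m A :
  (k <= m)%N -> kyfan_norm k A = \sum_(i < m | (i < k)%N) eigval A i.+1.
Proof.
move=> le_km; rewrite /kyfan_norm big_add1 /= big_mkord.
by rewrite (big_ord_widen m (fun i => eigval A i.+1)).
Qed.

(** The range [m] is left free: [m = p] matches prefix sums of the whole spectrum, while [m = k]
    allows majorization among the [k] smallest eigenvalues alone. *)
Lemma kyfan_antinormE k m A :
  (k <= m)%N -> kyfan_antinorm k A = \sum_(i < m | (i < k)%N) eigval A (p - i).
Proof.
move=> le_km; rewrite /kyfan_antinorm big_add1 /= big_mkord.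
rewrite (big_ord_widen m (fun i => eigval A (p + 1 - i.+1))) //.
by apply: eq_bigr => i _; rewrite addn1 subSS.
Qed.

(** Conjugation disappears under the trace; the sum over the unsorted spectrum is then reindexed by
    the sorting permutation. *)
Lemma trfE f A : trf f A = \sum_(i < p) f (eigval A i.+1).
Proof.
have [s Es] := eigval_perm A.
rewrite /trf /mxfun -mulmxA mxtrace_mulC mulmxK ?spectral_unit //.
rewrite mxtrace_diag Re_sum (reindex_inj (@perm_inj _ s)) /=.
by apply: eq_bigr => i _; rewrite mxE Es.
Qed.

Lemma sum_eigval_rev (f : R -> R) A :
  \sum_(i < p) f (eigval A (p - i)) = \sum_(i < p) f (eigval A i.+1).
Proof.
rewrite [RHS](reindex_inj rev_ord_inj) /=.
by apply: eq_bigr => i _; rewrite subnSK.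
Qed.

End Diagonalization.

(** * Ky Fan anti-norms as minima over unitaries *)

Section KyFan.
Variables (R : realType) (p k : nat).
Hypothesis le_kp : (k <= p)%N.
Local Notation C := R[i].
Implicit Types (A B U V W X Y : 'M[C]_p).

(** The real part of the trace of the leading block of size [k]. On Hermitian matrices, the Ky Fan
    anti-norm and norm are the minimum and maximum of this real-linear functional over unitary
    conjugates. *)
Definition diag_sum (X : 'M[C]_p) : R :=
  \sum_(i < p | (i < k)%N) complex.Re (X i i).

Lemma diag_sumD X Y : diag_sum (X + Y) = diag_sum X + diag_sum Y.
Proof. by rewrite -big_split; apply: eq_bigr => i _; rewrite mxE ReD. Qed.

Lemma diag_sumZ (t : R) X : diag_sum (cR t *: X) = t * diag_sum X.
Proof. by rewrite mulr_sumr; apply: eq_bigr => i _; rewrite mxE Re_cRM. Qed.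

Lemma conjmxD U A B :
  U *m (A + B) *m adj U = U *m A *m adj U + U *m B *m adj U.
Proof. by rewrite mulmxDr mulmxDl. Qed.

Lemma conjmxZ U (c : C) A : U *m (c *: A) *m adj U = c *: (U *m A *m adj U).
Proof. by rewrite -scalemxAr -scalemxAl. Qed.

Lemma kyfan_antinorm_le A U : adj A = A -> U \is unitarymx ->
  kyfan_antinorm k A <= diag_sum (U *m A *m adj U).
Proof.
move=> /diagonalizes_eigval_incr[W dA] U_unit; rewrite (kyfan_antinormE A le_kp).
exact: (ky_fan_min dA U_unit (@eigval_incr _ _ A) le_kp).
Qed.

Lemma kyfan_antinorm_attained A : adj A = A ->
  exists2 U, U \is unitarymx & kyfan_antinorm k A = diag_sum (U *m A *m adj U).
Proof.
move=> /diagonalizes_eigval_incr[W dA]; exists W; first exact: dA.1.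
rewrite (kyfan_antinormE A le_kp) (diagonalizes_conj dA).
by apply: eq_bigr => i _; rewrite diagRE eqxx.
Qed.

Lemma kyfan_norm_ge A U : adj A = A -> U \is unitarymx ->
  diag_sum (U *m A *m adj U) <= kyfan_norm k A.
Proof.
move=> /diagonalizes_eigval_decr[W dA] U_unit; rewrite (kyfan_normE A le_kp).
apply: (ky_fan_max dA U_unit _ le_kp) => i j le_ij.
by apply: eigval_decr; rewrite le_ij ltn_ord.
Qed.

Lemma kyfan_norm_attained A : adj A = A ->
  exists2 U, U \is unitarymx & kyfan_norm k A = diag_sum (U *m A *m adj U).
Proof.
move=> /diagonalizes_eigval_decr[W dA]; exists W; first exact: dA.1.
rewrite (kyfan_normE A le_kp) (diagonalizes_conj dA).
by apply: eq_bigr => i _; rewrite diagRE eqxx.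
Qed.

Lemma unitary_entry_le1 U i j : U \is unitarymx -> cabs (U i j) <= 1.
Proof.
move=> /(@unitary_row_sum _ _ _ i); rewrite (bigD1 j) //= => sum1.
rewrite -(@ler_sqr _ (cabs _)) ?nnegrE ?cabs_ge0 // expr1n -sum1 lerDl.
by apply: sumr_ge0 => a _; exact: sqr_ge0.
Qed.

(** A crude bound, but uniform in both unitaries: it yields continuity of the anti-norms and
    finiteness of the supremum defining [kyfan_ext]. *)
Lemma unitary_prod_entry_le U V X i j : U \is unitarymx -> V \is unitarymx ->
  cabs ((U *m X *m V) i j) <= \sum_a \sum_b cabs (X a b).
Proof.
move=> U_unit V_unit; rewrite mxE exchange_big /=.
apply: (le_trans (cabs_sum _ _)); apply: ler_sum => b _.
rewrite cabsM -[leRHS]mulr1; apply: ler_pM; rewrite ?cabs_ge0 //; last first.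
  exact: unitary_entry_le1.
rewrite mxE; apply: (le_trans (cabs_sum _ _)); apply: ler_sum => a _.
rewrite cabsM -[leRHS]mul1r; apply: ler_pM; rewrite ?cabs_ge0 //.
exact: unitary_entry_le1.
Qed.

Lemma diag_sum_conj_le U X (e : R) : U \is unitarymx ->
  (forall i j, cabs (X i j) <= e) ->
  diag_sum (U *m X *m adj U) <= e *+ p *+ p *+ p.
Proof.
move=> U_unit X_le.
have sum_le : \sum_a \sum_b cabs (X a b) <= e *+ p *+ p.
  have -> : e *+ p *+ p = \sum_(a < p) \sum_(b < p) e.
    by rewrite !sumr_const card_ord.
  by apply: ler_sum => a _; apply: ler_sum => b _.
have sum_ge0 : 0 <= \sum_a \sum_b cabs (X a b).
  by apply: sumr_ge0 => a _; apply: sumr_ge0 => b _; exact: cabs_ge0.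
have -> : e *+ p *+ p *+ p = \sum_(i < p) (e *+ p *+ p).
  by rewrite sumr_const card_ord.
(* Indices outside the first [k] contribute 0, so nonnegativity of the bound lets all [p] terms be
   estimated alike. *)
rewrite /diag_sum big_mkcond /=; apply: ler_sum => i _; apply: le_trans sum_le.
case: ifP => // _; apply: (le_trans (Re_le_cabs _)).
exact: (unitary_prod_entry_le _ _ _ U_unit (unitary_adj U_unit)).
Qed.

Lemma conjmx_herm U A : adj A = A -> adj (U *m A *m adj U) = U *m A *m adj U.
Proof. by move=> A_herm; rewrite !adjM adjK A_herm mulmxA. Qed.

(** One inequality is enough for unitary invariance: the reverse one is this lemma for [adj U] and
    the conjugated matrix. *)
Lemma kyfan_antinorm_conj_le U A : U \is unitarymx -> adj A = A ->
  kyfan_antinorm k (U *m A *m adj U) <= kyfan_antinorm k A.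
Proof.
move=> U_unit A_herm; have [V V_unit ->] := kyfan_antinorm_attained A_herm.
have VU_unit := mul_unitarymx V_unit (unitary_adj U_unit).
apply: (le_trans (kyfan_antinorm_le (conjmx_herm U A_herm) VU_unit)).
rewrite adjM adjK !mulmxA -(mulmxA V (adj U)) (unitary_adj_mul U_unit) mulmx1.
by rewrite -(mulmxA _ (adj U)) (unitary_adj_mul U_unit) mulmx1.
Qed.

(** The unitary attaining the minimum for [A] is tested on [B]; by linearity the excess is the
    diagonal sum of a conjugate of [B - A]. *)
Lemma kyfan_antinorm_lipschitz A B (e : R) : adj A = A -> adj B = B ->
  (forall i j, cabs (B i j - A i j) <= e) ->
  kyfan_antinorm k B - kyfan_antinorm k A <= e *+ p *+ p *+ p.
Proof.
move=> A_herm B_herm BA_le; have [U U_unit ->] := kyfan_antinorm_attained A_herm.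
rewrite lerBlDr; apply: (le_trans (kyfan_antinorm_le B_herm U_unit)).
rewrite -{1}[B](subrK A) conjmxD diag_sumD lerD2r.
by apply: (diag_sum_conj_le U_unit) => i j; rewrite !mxE.
Qed.

(** A minimum of linear functionals is superadditive and positively homogeneous; each inequality
    tests the minimizer of one matrix on another. *)
Lemma kyfan_antinorm_symmetric : symmetric_antinorm (@kyfan_antinorm R p k).
Proof.
split.
- move=> A [A_herm A_ge0]; have [U U_unit ->] := kyfan_antinorm_attained A_herm.
  by apply: sumr_ge0 => i _; rewrite diag_entry_form Re_ge0.
- move=> A [A_herm _] e e_gt0; pose P3 : R := (p * p * p)%:R.
  have P3_ge0 : 0 <= P3 by exact: ler0n.
  have P3E (x : R) : x *+ p *+ p *+ p = x * P3 by rewrite /P3 mulr_natr !mulrnA.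
  (* [P3] is the Lipschitz constant; the added 1 keeps the denominator positive when [p = 0] and
     makes the final bound strict. *)
  exists (e / (P3 + 1)); first by rewrite divr_gt0 //; lra.
  move=> B [B_herm _] BA_lt.
  have small : e / (P3 + 1) * P3 < e.
    rewrite mulrAC ltr_pdivrMr; last by lra.
    by nra.
  have le1 := @kyfan_antinorm_lipschitz A B _ A_herm B_herm (fun i j => ltW (BA_lt i j)).
  have le2 : kyfan_antinorm k A - kyfan_antinorm k B <= (e / (P3 + 1)) *+ p *+ p *+ p.
    apply: kyfan_antinorm_lipschitz => // i j.
    by rewrite /cabs distrC; exact: ltW (BA_lt i j).
  rewrite P3E in le1; rewrite P3E in le2.
  by rewrite ltr_norml; lra.
- move=> t A t_ge0 [A_herm _]; apply/eqP; rewrite eq_le; apply/andP; split.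
    have [U U_unit ->] := kyfan_antinorm_attained A_herm.
    rewrite -diag_sumZ -conjmxZ; apply: kyfan_antinorm_le => //.
    by rewrite adj_cRZ A_herm.
  have tA_herm : adj (cR t *: A) = cR t *: A by rewrite adj_cRZ A_herm.
  have [U U_unit ->] := kyfan_antinorm_attained tA_herm.
  by rewrite conjmxZ diag_sumZ ler_wpM2l // kyfan_antinorm_le.
- move=> U A U_unit [A_herm _]; apply/eqP; rewrite eq_le kyfan_antinorm_conj_le //=.
  have := kyfan_antinorm_conj_le (unitary_adj U_unit) (conjmx_herm U A_herm).
  rewrite adjK !mulmxA (unitary_adj_mul U_unit) mul1mx.
  by rewrite -mulmxA (unitary_adj_mul U_unit) mulmx1.
- move=> A B [A_herm _] [B_herm _].
  have AB_herm : adj (A + B) = A + B by rewrite adjD A_herm B_herm.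
  have [U U_unit ->] := kyfan_antinorm_attained AB_herm.
  by rewrite conjmxD diag_sumD lerD // kyfan_antinorm_le.
Qed.

End KyFan.

(** * Ky Fan norms extended to all matrices *)

Section KyFanExtension.
Variables (R : realType) (p k : nat).
Hypothesis k_bounds : (1 <= k <= p)%N.
Local Notation C := R[i].
Implicit Types (A B U V W X Y : 'M[C]_p).

Let le_kp : (k <= p)%N. Proof. by case/andP: k_bounds. Qed.

(** Moduli instead of real parts make the sum nonnegative and absolutely homogeneous for complex
    scalars. *)
Definition abs_diag_sum (X : 'M[C]_p) : R :=
  \sum_(i < p | (i < k)%N) cabs (X i i).

Definition unitary_diag_sums X : set R :=
  [set s | exists U V, [/\ U \is unitarymx, V \is unitarymx &
                           s = abs_diag_sum (U *m X *m V)]].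

(* [kyfan_norm] is meaningful only on Hermitian matrices; this is the sum of the
   [k] largest singular values, written variationally. *)
Definition kyfan_ext X : R := sup (unitary_diag_sums X).

Lemma unitary1 : (1%:M : 'M[C]_p) \is unitarymx.
Proof. by case: (@diagonalizes_diagR R p (fun=> 0)). Qed.

Lemma unitary_diag_sums_has_sup X : has_sup (unitary_diag_sums X).
Proof.
split.
  exists (abs_diag_sum (1%:M *m X *m 1%:M)), 1%:M, 1%:M.
  by split=> //; exact: unitary1.
exists (\sum_(i < p | (i < k)%N) \sum_a \sum_b cabs (X a b)).
move=> _ [U [V [U_unit V_unit ->]]]; apply: ler_sum => i _.
exact: unitary_prod_entry_le.
Qed.

Lemma abs_diag_sum_le U V X : U \is unitarymx -> V \is unitarymx ->
  abs_diag_sum (U *m X *m V) <= kyfan_ext X.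
Proof.
move=> U_unit V_unit; apply: sup_upper_bound; last by exists U, V.
exact: unitary_diag_sums_has_sup.
Qed.

Lemma kyfan_ext_le X (b : R) :
  (forall U V, U \is unitarymx -> V \is unitarymx ->
     abs_diag_sum (U *m X *m V) <= b) -> kyfan_ext X <= b.
Proof.
move=> le_b; apply: ge_sup; first by case: (unitary_diag_sums_has_sup X).
by move=> _ [U [V [U_unit V_unit ->]]]; exact: le_b.
Qed.

Lemma abs_diag_sum_ge0 X : 0 <= abs_diag_sum X.
Proof. by apply: sumr_ge0 => i _; exact: cabs_ge0. Qed.

Lemma kyfan_ext_unitary_le U V X : U \is unitarymx -> V \is unitarymx ->
  kyfan_ext (U *m X *m V) <= kyfan_ext X.
Proof.
move=> U_unit V_unit; apply: kyfan_ext_le => U' V' U'_unit V'_unit.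
have -> : U' *m (U *m X *m V) *m V' = (U' *m U) *m X *m (V *m V').
  by rewrite !mulmxA.
apply: abs_diag_sum_le; first exact: (mul_unitarymx U'_unit U_unit).
exact: (mul_unitarymx V_unit V'_unit).
Qed.

Lemma kyfan_extZ_le (c : C) X : kyfan_ext (c *: X) <= cabs c * kyfan_ext X.
Proof.
apply: kyfan_ext_le => U V U_unit V_unit.
rewrite -scalemxAr -scalemxAl.
have -> : abs_diag_sum (c *: (U *m X *m V)) = cabs c * abs_diag_sum (U *m X *m V).
  by rewrite mulr_sumr; apply: eq_bigr => i _; rewrite mxE cabsM.
by rewrite ler_wpM2l ?cabs_ge0 // abs_diag_sum_le.
Qed.

Lemma kyfan_ext_symmetric : symmetric_norm kyfan_ext.
Proof.
split.
- move=> X; apply: (le_trans (abs_diag_sum_ge0 _)).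
  exact: (abs_diag_sum_le X unitary1 unitary1).
(* Transpositions bring any entry of [X] to the corner, which is counted because [1 <= k]; hence
   every entry vanishes. *)
- move=> X X0; apply/matrixP => a b; rewrite [RHS]mxE.
  have p_gt0 : (0 < p)%N by case/andP: k_bounds => /leq_trans; apply.
  pose i0 : 'I_p := Ordinal p_gt0.
  have := abs_diag_sum_le X (perm_mx_unitary R (tperm i0 a))
            (perm_mx_unitary R (tperm i0 b)).
  rewrite X0 /abs_diag_sum (bigD1 i0) /=; last by case/andP: k_bounds.
  have -> : (perm_mx (tperm i0 a) *m X *m perm_mx (tperm i0 b)) i0 i0 = X a b.
    by rewrite -row_permE -(tpermV i0 b) -col_permE !mxE !tpermL.
  move=> sum_le0; apply/cabs_eq0/eqP; rewrite eq_le cabs_ge0 andbT.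
  apply: le_trans sum_le0; rewrite lerDl; apply: sumr_ge0 => i _; exact: cabs_ge0.
- move=> c X; apply/eqP; rewrite eq_le kyfan_extZ_le /=.
  have [->|c_neq0] := eqVneq c 0.
    rewrite {1}/cabs normr0 /= mul0r; apply: (le_trans (abs_diag_sum_ge0 _)).
    exact: (abs_diag_sum_le _ unitary1 unitary1).
  (* The reverse inequality is the first one applied to [c^-1] and [c *: X]. *)
  have := kyfan_extZ_le c^-1 (c *: X); rewrite scalerA mulVf // scale1r.
  have cabs_neq0 : cabs c != 0 by apply: contra c_neq0 => /eqP/cabs_eq0/eqP.
  have -> : cabs c^-1 = (cabs c)^-1.
    apply: (mulIf cabs_neq0); rewrite -cabsM !mulVf // /cabs normr1 //.
  by rewrite ler_pdivlMl // lt_def cabs_neq0 cabs_ge0.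
- move=> X Y; apply: kyfan_ext_le => U V U_unit V_unit.
  rewrite mulmxDr mulmxDl.
  apply: le_trans (lerD (abs_diag_sum_le X U_unit V_unit) (abs_diag_sum_le Y U_unit V_unit)).
  by rewrite -big_split; apply: ler_sum => i _; rewrite mxE cabsD.
- move=> U V X U_unit V_unit; apply: le_anti; apply/andP.
  split; first exact: (kyfan_ext_unitary_le X U_unit V_unit).
  have := kyfan_ext_unitary_le (U *m X *m V) (unitary_adj U_unit) (unitary_adj V_unit).
  rewrite !mulmxA (unitary_adj_mul U_unit) mul1mx -mulmxA.
  by rewrite (unitary_mul_adj V_unit) mulmx1.
Qed.

(* Positivity of [A] at [v - c w], with the phase [c] making [v^* A w] real. *)
Lemma psd_cauchy_schwarz A (v w : 'cV[C]_p) : psdmx A ->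
  2 * cabs ((adj v *m A *m w) 0 0)
    <= complex.Re ((adj v *m A *m v) 0 0) + complex.Re ((adj w *m A *m w) 0 0).
Proof.
move=> [A_herm A_ge0].
set z := (adj v *m A *m w) 0 0.
have wAv : (adj w *m A *m v) 0 0 = z^*.
  have -> : adj w *m A *m v = adj (adj v *m A *m w) by rewrite !adjM adjK A_herm mulmxA.
  by rewrite mxE mxE.
have [c cc cz] : exists2 c : C, c * c^* = 1 & c * z = cR (cabs z).
  have [->|z_neq0] := eqVneq z 0.
    by exists 1; rewrite ?rmorph1 ?mulr1 // mulr0 -normE normr0.
  have nz_neq0 : `|z| != 0 by rewrite normr_eq0.
  exists (z^* / `|z|); last first.
    by rewrite mulrAC [_^* * _]mulrC -normCK expr2 mulfK // normE.
  by rewrite -normCK normf_div norm_conjC normr_id divff // expr1n.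
have := A_ge0 (v - c *: w).
have -> : (adj (v - c *: w) *m A *m (v - c *: w)) 0 0 =
    (adj v *m A *m v) 0 0 + (adj w *m A *m w) 0 0 - cR (cabs z) - cR (cabs z).
  have -> : adj (v - c *: w) = adj v - c^* *: adj w.
    by apply/matrixP => i j; rewrite !mxE rmorphB rmorphM.
  have cz' : c^* * z^* = cR (cabs z) by rewrite -rmorphM /= cz conj_cR.
  rewrite mulmxBl mulmxBr !mulmxBl -!scalemxAl -!scalemxAr !scalerA.
  rewrite [c^* * c]mulrC cc scale1r -{1}cz -cz' -wAv /z.
  move: (adj v *m A *m v) (adj w *m A *m w) => a b.
  move: (adj v *m A *m w) (adj w *m A *m v) => e f.
  by rewrite !mxE; ring.
by move/Re_ge0; rewrite !ReD !ReN /=; lra.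
Qed.

(** For positive semidefinite [A], Cauchy-Schwarz bounds each modulus on the diagonal of
    [U *m A *m V] by the mean of the corresponding entries of two unitary conjugates of [A], and Ky
    Fan's principle bounds their sums. Taking [V = adj U] with [U] optimal gives equality. *)
Lemma kyfan_extE A : psdmx A -> kyfan_ext A = kyfan_norm k A.
Proof.
move=> A_psd; have A_herm := A_psd.1; apply/eqP; rewrite eq_le; apply/andP; split.
  apply: kyfan_ext_le => U V U_unit V_unit.
  suff le2 : 2 * abs_diag_sum (U *m A *m V) <=
      diag_sum k (U *m A *m adj U) + diag_sum k (adj V *m A *m adj (adj V)).
    have := kyfan_norm_ge le_kp A_herm U_unit.
    have := kyfan_norm_ge le_kp A_herm (unitary_adj V_unit).
    by lra.
  rewrite mulr_sumr -big_split; apply: ler_sum => i _.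
  have -> : (U *m A *m V) i i = (adj (col i (adj U)) *m A *m col i V) 0 0.
    have -> : adj (col i (adj U)) = row i U.
      by apply/matrixP => a b; rewrite !mxE conjCK.
    by rewrite -row_mul !mxE; apply: eq_bigr => j _; rewrite !mxE.
  by rewrite /= !diag_entry_form !adjK; exact: psd_cauchy_schwarz.
have [U U_unit ->] := kyfan_norm_attained le_kp A_herm.
apply: le_trans (abs_diag_sum_le A U_unit (unitary_adj U_unit)).
by apply: ler_sum => i _; exact: Re_le_cabs.
Qed.

End KyFanExtension.

(** * Symmetric anti-norms and supermajorization *)

Section Antinorms.
Variables (R : realType) (p : nat) (N : 'M[R[i]]_p -> R).
Hypothesis N_anti : symmetric_antinorm N.
Implicit Types (x z : 'I_p -> R).

Lemma psd_diagR x : (forall i, 0 <= x i) -> psdmx (diagR x).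
Proof. by move=> x_ge0; apply: diagonalizes_psd (diagonalizes_diagR x) _. Qed.

Lemma psdZ (t : R) (A : 'M[R[i]]_p) : 0 <= t -> psdmx A -> psdmx (cR t *: A).
Proof.
move=> t_ge0 [A_herm A_ge0]; split=> [|v]; first by rewrite adj_cRZ A_herm.
by rewrite -scalemxAr -scalemxAl mxE mulr_ge0 // cR_ge0.
Qed.

Lemma antinorm_diagonalizes W x A :
  diagonalizes W x A -> (forall i, 0 <= x i) -> N A = N (diagR x).
Proof.
case: N_anti => _ _ _ N_unit _ [W_unit ->] /psd_diagR x_psd.
by have := N_unit _ _ (unitary_adj W_unit) x_psd; rewrite adjK.
Qed.

Lemma antinorm_comb (t : R) x z : 0 <= t <= 1 ->
  (forall i, 0 <= x i) -> (forall i, 0 <= z i) ->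
  t * N (diagR x) + (1 - t) * N (diagR z)
    <= N (diagR (fun i => t * x i + (1 - t) * z i)).
Proof.
case: N_anti => _ _ N_hom _ N_add /andP[t_ge0 t_le1] /psd_diagR x_psd /psd_diagR z_psd.
have t'_ge0 : 0 <= 1 - t by rewrite subr_ge0.
rewrite diagR_comb -!N_hom //; apply: N_add; exact: psdZ.
Qed.

(** On nonnegative diagonals [N] is concave and permutation invariant, so T-transforms do not
    decrease it. Nonnegativity is carried in [P] since [N] is controlled only on positive
    semidefinite matrices. *)
Lemma antinorm_supermajorization x z :
  {homo x : i j / (i <= j)%N >-> i <= j} ->
  (forall k, (k <= p)%N ->
     \sum_(i < p | (i < k)%N) z i <= \sum_(i < p | (i < k)%N) x i) ->
  (forall i, 0 <= z i) -> N (diagR z) <= N (diagR x).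
Proof.
move=> x_incr z_le_x z_ge0.
pose P (w : 'I_p -> R) := (forall i, 0 <= w i) /\ N (diagR z) <= N (diagR w).
have [w [w_ge0 le_w] le_wx] : exists2 w, P w & forall i, w i <= x i.
  apply: (@weak_supermajorization_ind _ _ P x z) => //.
  move=> w i j t [w_ge0 le_w] t01.
  have /andP[t_ge0 t_le1] := t01.
  split=> [a|]; first by rewrite addr_ge0 ?mulr_ge0 ?subr_ge0.
  apply: le_trans (antinorm_comb t01 w_ge0 (fun a => w_ge0 (tperm i j a))).
  rewrite -perm_diagR; case: N_anti => _ _ _ N_unit _.
  rewrite N_unit ?perm_mx_unitary //; last exact: psd_diagR.
  by rewrite -mulrDl addrC subrK mul1r.
(* Monotonicity: superadditivity together with [N >= 0] on the positive semidefinite difference. *)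
apply: (le_trans le_w); case: N_anti => N_ge0 _ _ _ N_add.
have xw_psd : psdmx (diagR (fun i => x i - w i)).
  by apply: psd_diagR => i; rewrite subr_ge0.
have -> : diagR x = diagR w + diagR (fun i => x i - w i).
  apply/matrixP => i j; rewrite [RHS]mxE !diagRE; case: eqP => _; last by rewrite addr0.
  by rewrite -cRD addrC subrK.
by apply: le_trans (N_add _ _ (psd_diagR w_ge0) xw_psd); rewrite lerDl N_ge0.
Qed.

End Antinorms.

(** * Symmetric norms and submajorization *)

Section Norms.
Variables (R : realType) (p : nat) (N : 'M[R[i]]_p -> R).
Hypothesis N_norm : symmetric_norm N.
Local Notation C := R[i].
Implicit Types (x z : 'I_p -> R).

Lemma norm_diagonalizes W x A : diagonalizes W x A -> N A = N (diagR x).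
Proof.
case: N_norm => _ _ _ _ N_unit [W_unit ->].
exact: (N_unit _ _ _ (unitary_adj W_unit) W_unit).
Qed.

Lemma norm_comb (t : R) x z : 0 <= t <= 1 ->
  N (diagR (fun i => t * x i + (1 - t) * z i))
    <= t * N (diagR x) + (1 - t) * N (diagR z).
Proof.
case: N_norm => _ _ N_hom N_add _ /andP[t_ge0 t_le1].
have t'_ge0 : 0 <= 1 - t by rewrite subr_ge0.
by rewrite diagR_comb (le_trans (N_add _ _)) // !N_hom !cabs_cR.
Qed.

Lemma unit_diag_unitary (c : 'I_p -> C) : (forall i, `|c i| = 1) ->
  diag_mx (\row_i c i) \is unitarymx.
Proof.
move=> c1; apply/unitarymxP/matrixP => i j; rewrite mul_diag_mx !mxE eq_sym.
by case: eqP => [->|_]; rewrite ?rmorph0 ?mulr0 // -normCK c1 expr1n.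
Qed.

(* A ratio [r = x i / z i] in [0, 1] is the real part of some [c] of modulus one,
   so shrinking a diagonal matrix is averaging it over two diagonal unitaries. *)
Lemma norm_diagR_le x z :
  (forall i, 0 <= x i <= z i) -> N (diagR x) <= N (diagR z).
Proof.
case: N_norm => _ _ N_hom N_add N_unit xz.
(* Where [z i = 0], also [x i = 0], and the convention that 0 has inverse 0 gives [r i = 0]; so
   [x i = r i * z i] holds throughout. *)
pose r i := x i / z i.
have r01 i : 0 <= r i <= 1.
  have /andP[x_ge0 le_xz] := xz i; have z_ge0 := le_trans x_ge0 le_xz.
  rewrite divr_ge0 //=; have [z0|z_neq0] := eqVneq (z i) 0.
    by rewrite /r z0 invr0 mulr0 ler01.
  by rewrite ler_pdivrMr ?mul1r // lt_def z_neq0.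
have xE i : x i = r i * z i.
  have /andP[x_ge0 le_xz] := xz i; have [z0|z_neq0] := eqVneq (z i) 0.
    by rewrite z0 mulr0; apply/eqP; rewrite eq_le x_ge0 andbT -z0.
  by rewrite divfK.
pose s i := Num.sqrt (1 - r i ^+ 2).
have s2 i : s i ^+ 2 = 1 - r i ^+ 2.
  by rewrite sqr_sqrtr // subr_ge0 expr_le1 //; case/andP: (r01 i).
pose D (e : R) := diag_mx (\row_i Complex (r i) (e * s i)) : 'M[C]_p.
have D_unit (e : R) : e ^+ 2 = 1 -> D e \is unitarymx.
  move=> e2; apply: (unit_diag_unitary (c := fun i => Complex (r i) (e * s i))) => i.
  by rewrite normc_def /= (exprMn _ e) e2 mul1r s2 addrC subrK sqrtr1.
have ND (e : R) : e ^+ 2 = 1 -> N (D e *m diagR z) = N (diagR z).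
  move=> /D_unit De_unit; have := N_unit _ _ (diagR z) De_unit (unitary1 R p).
  by rewrite mulmx1.
have -> : diagR x = cR 2^-1 *: (D 1 *m diagR z) + cR 2^-1 *: (D (- 1) *m diagR z).
  apply/matrixP => i j; rewrite !mul_diag_mx !mxE xE.
  case: eqP => _; last by rewrite !mulr0n !mulr0 addr0.
  apply/eqP; rewrite eq_complex /=; apply/andP.
  by split; apply/eqP; field.
apply: (le_trans (N_add _ _)); rewrite !N_hom !ND ?sqrrN ?expr1n //.
by rewrite cabs_cR ?invr_ge0 ?ler0n //; lra.
Qed.

(** The T-transforms act on the negated vectors, for which [- x] is increasing. They end at some [w]
    with [x i <= - w i]; as [x] is nonnegative, [norm_diagR_le] finishes. *)
Lemma norm_submajorization x z :
  {homo x : i j / (i <= j)%N >-> j <= i} ->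
  (forall k, (k <= p)%N ->
     \sum_(i < p | (i < k)%N) x i <= \sum_(i < p | (i < k)%N) z i) ->
  (forall i, 0 <= x i) -> N (diagR x) <= N (diagR z).
Proof.
move=> x_decr x_le_z x_ge0.
pose P (w : 'I_p -> R) := N (diagR (fun i => - w i)) <= N (diagR z).
have [w le_w le_wx] : exists2 w, P w & forall i, w i <= - x i.
  apply: (@weak_supermajorization_ind _ _ P _ (fun i => - z i)).
  - move=> w i j t le_w t01; rewrite /P.
    rewrite (@eq_diagR _ _ _ (fun a => t * - w a + (1 - t) * - w (tperm i j a)));
      last by move=> a; ring.
    apply: (le_trans (norm_comb _ _ t01)).
    rewrite -(perm_diagR (fun a => - w a)); case: N_norm => _ _ _ _ N_unit.
    have s_unit := perm_mx_unitary R (tperm i j).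
    rewrite (N_unit _ _ _ s_unit (unitary_adj s_unit)).
    by rewrite -mulrDl addrC subrK mul1r.
  - by move=> i j le_ij; rewrite lerN2; exact: x_decr.
  - by move=> k le_kp; rewrite !sumrN lerN2; exact: x_le_z.
  - by rewrite /P; under eq_diagR do rewrite opprK.
apply: le_trans le_w; apply: norm_diagR_le => i.
by rewrite x_ge0 lerNr le_wx.
Qed.

End Norms.

(** * Convexity of the positive half-line and of the reciprocal *)

Lemma pos_comb (K : numDomainType) (u v s : K) :
  0 < u -> 0 < v -> 0 <= s <= 1 -> 0 < s * u + (1 - s) * v.
Proof.
move=> u_gt0 v_gt0 /andP[s_ge0 s_le1].
have [->|s_neq0] := eqVneq s 0; first by rewrite mul0r add0r subr0 mul1r.
apply: ltr_pwDl; first by rewrite mulr_gt0 // lt_def s_neq0.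
by rewrite mulr_ge0 ?subr_ge0 // ltW.
Qed.

Lemma inv_convex (K : realFieldType) (u v s : K) : 0 < u -> 0 < v -> 0 <= s <= 1 ->
  (s * u + (1 - s) * v)^-1 <= s * u^-1 + (1 - s) * v^-1.
Proof.
move=> u_gt0 v_gt0 s01; have w_gt0 := pos_comb u_gt0 v_gt0 s01.
have /andP[s_ge0 s_le1] := s01.
have -> : s * u^-1 + (1 - s) * v^-1 = (s * v + (1 - s) * u) / (u * v).
  by field; rewrite !gt_eqF.
rewrite ler_pdivlMr ?mulr_gt0 // mulrC ler_pdivrMr //.
have -> : (s * v + (1 - s) * u) * (s * u + (1 - s) * v) =
  u * v + s * (1 - s) * (u - v) ^+ 2 by ring.
by rewrite lerDl mulr_ge0 ?sqr_ge0 // mulr_ge0 // subr_ge0.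
Qed.

(** * Comparison of the spectra at one convex combination *)

Section SpectralComparisons.
Variables (R : realType) (l : nat).
Local Notation C := R[i].
Variables (X Y1 Y2 : 'M[C]_l) (t : R).
Hypotheses (X_pd : pdmx X) (Y1_pd : pdmx Y1) (Y2_pd : pdmx Y2).
Hypothesis t01 : 0 <= t <= 1.

Lemma eigval_rev_gt0 (Y : 'M[C]_l) i : pdmx Y -> (i < l)%N -> 0 < eigval Y (l - i).
Proof. by move=> Y_pd lt_il; apply: eigval_gt0 => //; lia. Qed.

Lemma eigval_inv_gt0 (Y : 'M[C]_l) (i : 'I_l) :
  pdmx Y -> 0 < eigval (invmx Y) i.+1.
Proof. by move=> Y_pd; rewrite eigval_inv // invr_gt0 eigval_rev_gt0. Qed.

(** Condition (a)' at a single convex combination, with [F] replaced by its three values;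
    [inv_norms_convex] does the same for (b)'. *)
Definition antinorms_concave := forall k, (1 <= k <= l)%N ->
  t * kyfan_antinorm k Y1 + (1 - t) * kyfan_antinorm k Y2 <= kyfan_antinorm k X.

Definition inv_norms_convex := forall k, (1 <= k <= l)%N ->
  kyfan_norm k (invmx X)
    <= t * kyfan_norm k (invmx Y1) + (1 - t) * kyfan_norm k (invmx Y2).

Lemma antinorms_concave_prefix m k : antinorms_concave -> (k <= m <= l)%N ->
  \sum_(i < m | (i < k)%N) (t * eigval Y1 (l - i) + (1 - t) * eigval Y2 (l - i))
    <= \sum_(i < m | (i < k)%N) eigval X (l - i).
Proof.
(* The assumption starts at [k = 1]; for [k = 0] both sums are empty. *)
move=> conc /andP[le_km le_ml]; have [->|k_gt0] := posnP k.
  by rewrite !big1 // => i; rewrite ltn0.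
rewrite big_split /= -!mulr_sumr -!kyfan_antinormE //.
by apply: conc; rewrite k_gt0 (leq_trans le_km).
Qed.

Lemma inv_norms_convex_prefix k : inv_norms_convex -> (k <= l)%N ->
  \sum_(i < l | (i < k)%N) eigval (invmx X) i.+1
    <= \sum_(i < l | (i < k)%N)
         (t * eigval (invmx Y1) i.+1 + (1 - t) * eigval (invmx Y2) i.+1).
Proof.
move=> conv le_kl; have [->|k_gt0] := posnP k.
  by rewrite !big1 // => i; rewrite ltn0.
rewrite big_split /= -!mulr_sumr -!kyfan_normE //.
by apply: conv; rewrite k_gt0.
Qed.

(** Concavity of [N] on diagonals leads to the averaged spectrum, and supermajorization leads from
    there to the spectrum of [X]. *)
Lemma antinorms_concave_antinorm (N : 'M[C]_l -> R) :
  antinorms_concave -> symmetric_antinorm N -> t * N Y1 + (1 - t) * N Y2 <= N X.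
Proof.
move=> conc N_anti.
have NE (Y : 'M[C]_l) : pdmx Y -> N Y = N (diagR (fun i : 'I_l => eigval Y (l - i))).
  move=> Y_pd; have [W dY] := diagonalizes_eigval_incr Y_pd.1.
  by apply: (antinorm_diagonalizes N_anti dY) => i; rewrite ltW ?eigval_rev_gt0.
rewrite (NE _ X_pd) (NE _ Y1_pd) (NE _ Y2_pd).
have y_ge0 (Y : 'M[C]_l) : pdmx Y -> forall i : 'I_l, 0 <= eigval Y (l - i).
  by move=> Y_pd i; rewrite ltW ?eigval_rev_gt0.
apply: (le_trans (antinorm_comb N_anti t01 (y_ge0 _ Y1_pd) (y_ge0 _ Y2_pd))).
apply: (antinorm_supermajorization N_anti (@eigval_incr _ _ X)) => [k le_kl|i].
  by apply: antinorms_concave_prefix; rewrite ?le_kl ?leqnn.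
by rewrite ltW // pos_comb ?eigval_rev_gt0.
Qed.

Lemma antinorms_concave_trf (f : R -> R) : antinorms_concave ->
  nondecr_pos f -> concave_pos f -> t * trf f Y1 + (1 - t) * trf f Y2 <= trf f X.
Proof.
move=> conc f_incr f_conc; rewrite !trfE -!sum_eigval_rev.
apply: le_trans (_ : _ <= \sum_(i < l)
  f (t * eigval Y1 (l - i) + (1 - t) * eigval Y2 (l - i))) _.
  rewrite !mulr_sumr -big_split; apply: ler_sum => i _.
  by apply: f_conc; rewrite ?eigval_rev_gt0.
apply: (@sum_concave_supermajorization _ _ (fun u => 0 < u)) => //.
- exact: pos_comb.
- by move=> u v u_gt0 _; exact: f_incr.
- exact: eigval_incr.
- by move=> k le_kl; apply: antinorms_concave_prefix; rewrite ?le_kl ?leqnn.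
- by move=> i; rewrite eigval_rev_gt0.
- by move=> i; rewrite pos_comb ?eigval_rev_gt0.
Qed.

(** The [k] largest eigenvalues of an inverse are the reciprocals of the [k] smallest, so
    majorization is applied to vectors of length [k] with the increasing concave function
    [u |-> - u^-1]. *)
Lemma antinorms_concave_inv : antinorms_concave -> inv_norms_convex.
Proof.
move=> conc k /andP[k_gt0 le_kl].
have sumE (Y : 'M[C]_l) : pdmx Y ->
    kyfan_norm k (invmx Y) = \sum_(i < k) (eigval Y (l - i))^-1.
  move=> Y_pd; rewrite (kyfan_normE _ (leqnn k)).
  apply: eq_big => [i|i _]; first by rewrite ltn_ord.
  exact: (eigval_inv (widen_ord le_kl i) Y_pd).
rewrite !sumE //; apply: le_trans (_ : _ <= \sum_(i < k)
  (t * eigval Y1 (l - i) + (1 - t) * eigval Y2 (l - i))^-1) _; last first.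
  rewrite !mulr_sumr -big_split; apply: ler_sum => i _.
  by apply: inv_convex; rewrite ?eigval_rev_gt0 // (leq_trans (ltn_ord i)).
rewrite -lerN2 -!sumrN.
apply: (@sum_concave_supermajorization _ _ (fun u => 0 < u) (fun u => - u^-1)).
- exact: pos_comb.
- by move=> u v u_gt0 v_gt0 le_uv; rewrite lerN2 lef_pV2.
- move=> u v s u_gt0 v_gt0 s01.
  have := inv_convex u_gt0 v_gt0 s01; rewrite !mulrN; lra.
- by move=> i j le_ij; exact: (@eigval_incr _ _ X (widen_ord le_kl i) (widen_ord le_kl j)).
- by move=> q le_qk; apply: antinorms_concave_prefix; rewrite ?le_qk.
- by move=> i; rewrite eigval_rev_gt0 // (leq_trans (ltn_ord i)).
- by move=> i; rewrite pos_comb ?eigval_rev_gt0 // (leq_trans (ltn_ord i)).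
Qed.

Lemma inv_norms_convex_norm (N : 'M[C]_l -> R) :
  inv_norms_convex -> symmetric_norm N ->
  N (invmx X) <= t * N (invmx Y1) + (1 - t) * N (invmx Y2).
Proof.
move=> conv N_norm.
have NE (Y : 'M[C]_l) : pdmx Y ->
    N (invmx Y) = N (diagR (fun i : 'I_l => eigval (invmx Y) i.+1)).
  move=> Y_pd; have [V dY] := diagonalizes_eigval_decr Y_pd.1.
  have d_neq0 i := lt0r_neq0 (diagonalizes_pd_gt0 i dY Y_pd).
  have Yinv_herm := diagonalizes_herm (diagonalizes_inv dY d_neq0).
  have [W dYinv] := diagonalizes_eigval_decr Yinv_herm.
  exact: (norm_diagonalizes N_norm dYinv).
rewrite (NE _ X_pd) (NE _ Y1_pd) (NE _ Y2_pd); apply: le_trans (norm_comb N_norm _ _ t01).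
apply: (norm_submajorization N_norm) => [i j le_ij|k le_kl|i].
- by apply: eigval_decr; rewrite le_ij ltn_ord.
- exact: inv_norms_convex_prefix.
- by rewrite ltW // eigval_inv_gt0.
Qed.

Lemma inv_norms_convex_trf (f : R -> R) : inv_norms_convex ->
  nondecr_pos f -> convex_pos f ->
  trf f (invmx X) <= t * trf f (invmx Y1) + (1 - t) * trf f (invmx Y2).
Proof.
move=> conv f_incr f_conv; rewrite !trfE.
apply: le_trans (_ : _ <= \sum_(i < l)
  f (t * eigval (invmx Y1) i.+1 + (1 - t) * eigval (invmx Y2) i.+1)) _; last first.
  rewrite !mulr_sumr -big_split; apply: ler_sum => i _.
  by apply: f_conv; rewrite ?eigval_inv_gt0.
apply: (@sum_convex_submajorization _ _ (fun u => 0 < u)) => //.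
- exact: pos_comb.
- by move=> u v u_gt0 _; exact: f_incr.
- by move=> i j le_ij; apply: eigval_decr; rewrite le_ij ltn_ord.
- by move=> k le_kl; exact: inv_norms_convex_prefix.
- by move=> i; exact: eigval_inv_gt0.
- by move=> i; rewrite pos_comb ?eigval_inv_gt0.
Qed.

(** Reduces the traces in (d) to traces of the kind in (c). *)
Lemma trf_inv (f : R -> R) (Y : 'M[C]_l) : pdmx Y ->
  trf f (invmx Y) = trf (fun u => f u^-1) Y.
Proof.
move=> Y_pd; rewrite !trfE -(sum_eigval_rev (fun u => f u^-1)).
by apply: eq_bigr => i _; rewrite eigval_inv.
Qed.

Lemma trfN (f : R -> R) (Y : 'M[C]_l) : trf (fun u => - f u) Y = - trf f Y.
Proof. by rewrite !trfE sumrN. Qed.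

Lemma kyfan_ext_inv k (Y : 'M[C]_l) : (1 <= k <= l)%N -> pdmx Y ->
  kyfan_ext k (invmx Y) = kyfan_norm k (invmx Y).
Proof.
move=> k_bounds Y_pd; apply: kyfan_extE => //.
have [V dY] := diagonalizes_eigval_decr Y_pd.1.
have d_gt0 i := diagonalizes_pd_gt0 i dY Y_pd.
apply: (diagonalizes_psd (diagonalizes_inv dY (fun i => lt0r_neq0 (d_gt0 i)))).
by move=> i; rewrite invr_ge0 ltW.
Qed.

End SpectralComparisons.

(** * Test functions under inversion, and convexity of the positive definite cone *)

Lemma nondecr_oppr_inv (R : realType) (f : R -> R) :
  nondecr_pos f -> nondecr_pos (fun u => - f u^-1).
Proof.
move=> f_incr u v u_gt0 le_uv; have v_gt0 := lt_le_trans u_gt0 le_uv.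
by rewrite lerN2; apply: f_incr; rewrite ?invr_gt0 // lef_pV2.
Qed.

(** A non-decreasing convex function composed with the convex reciprocal is convex. *)
Lemma concave_oppr_inv (R : realType) (f : R -> R) :
  nondecr_pos f -> convex_pos f -> concave_pos (fun u => - f u^-1).
Proof.
move=> f_incr f_conv u v s u_gt0 v_gt0 s01; rewrite !mulrN -opprD lerN2.
apply: le_trans (f_conv _ _ _ _ _ s01); rewrite ?invr_gt0 //.
by apply: f_incr; [rewrite invr_gt0 pos_comb | exact: inv_convex].
Qed.

Lemma pd_comb (R : realType) n (A1 A2 : 'M[R[i]]_n) (t : R) :
  pdmx A1 -> pdmx A2 -> 0 <= t <= 1 -> pdmx (cR t *: A1 + cR (1 - t) *: A2).
Proof.
move=> [A1_herm A1_gt0] [A2_herm A2_gt0] t01; split=> [|v v_neq0].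
  by rewrite adjD !adj_cRZ A1_herm A2_herm.
rewrite mulmxDr mulmxDl -!scalemxAr -!scalemxAl.
rewrite mxE [X in _ < X + _]mxE [X in _ < _ + X]mxE.
have /andP[t_ge0 t_le1] := t01.
(* [pos_comb] is used over the complex numbers, where the quadratic forms take their values. *)
have -> : cR (1 - t) = 1 - cR t by exact: (rmorphB (real_complex R)).
apply: pos_comb; [exact: A1_gt0 | exact: A2_gt0 |].
by rewrite cR_ge0 t_ge0 -[1]/(cR 1) ler_cR.
Qed.

(** * Implications between the conditions on [F] *)

Theorem theorem4p1 (R : realType) (n m l : nat)
  (F : 'M[R[i]]_n -> 'M[R[i]]_m -> 'M[R[i]]_l)
  (HF : forall A B, pdmx A -> pdmx B -> pdmx (F A B)) :
  let cond_a := forall N : 'M[R[i]]_l -> R, symmetric_antinorm N ->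
      jointly_concave (fun A B => N (F A B)) in
  let cond_a' := forall k : nat, (1 <= k <= l)%N ->
      jointly_concave (fun A B => kyfan_antinorm k (F A B)) in
  let cond_b := forall N : 'M[R[i]]_l -> R, symmetric_norm N ->
      jointly_convex (fun A B => N (invmx (F A B))) in
  let cond_b' := forall k : nat, (1 <= k <= l)%N ->
      jointly_convex (fun A B => kyfan_norm k (invmx (F A B))) in
  let cond_c := forall f : R -> R, nondecr_pos f -> concave_pos f ->
      jointly_concave (fun A B => trf f (F A B)) in
  let cond_d := forall f : R -> R, nondecr_pos f -> convex_pos f ->
      jointly_convex (fun A B => trf f (invmx (F A B))) in
  ((cond_a <-> cond_a') /\ (cond_a' -> cond_b) /\ (cond_b <-> cond_b') /\
   (cond_b' -> cond_d)) /\ ((cond_a -> cond_c) /\ (cond_c -> cond_d)).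
Proof.
move=> cond_a cond_a' cond_b cond_b' cond_c cond_d.
have aa' : cond_a -> cond_a'.
  move=> a k /andP[_ le_kl]; exact: (a _ (kyfan_antinorm_symmetric R le_kl)).
have a'a : cond_a' -> cond_a.
  move=> a' N N_anti A1 A2 B1 B2 t A1p A2p B1p B2p t01.
  have Xp := HF _ _ (pd_comb A1p A2p t01) (pd_comb B1p B2p t01).
  apply: (antinorms_concave_antinorm Xp (HF _ _ A1p B1p) (HF _ _ A2p B2p) t01 _ N_anti).
  by move=> k k_bounds; exact: a'.
have b'b : cond_b' -> cond_b.
  move=> b' N N_norm A1 A2 B1 B2 t A1p A2p B1p B2p t01.
  have Xp := HF _ _ (pd_comb A1p A2p t01) (pd_comb B1p B2p t01).
  apply: (inv_norms_convex_norm Xp (HF _ _ A1p B1p) (HF _ _ A2p B2p) t01 _ N_norm).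
  by move=> k k_bounds; exact: b'.
have bb' : cond_b -> cond_b'.
  move=> b k k_bounds A1 A2 B1 B2 t A1p A2p B1p B2p t01.
  (* Condition (b) asks for a norm on all matrices; [kyfan_ext] is one, and it agrees with
     [kyfan_norm] on the inverses of positive definite values. *)
  have := b _ (kyfan_ext_symmetric R k_bounds) _ _ _ _ _ A1p A2p B1p B2p t01.
  have Xp := HF _ _ (pd_comb A1p A2p t01) (pd_comb B1p B2p t01).
  rewrite (kyfan_ext_inv k_bounds Xp) (kyfan_ext_inv k_bounds (HF _ _ A1p B1p)).
  by rewrite (kyfan_ext_inv k_bounds (HF _ _ A2p B2p)).
have a'b' : cond_a' -> cond_b'.
  move=> a' k k_bounds A1 A2 B1 B2 t A1p A2p B1p B2p t01.
  have Xp := HF _ _ (pd_comb A1p A2p t01) (pd_comb B1p B2p t01).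
  apply: (antinorms_concave_inv Xp (HF _ _ A1p B1p) (HF _ _ A2p B2p) t01 _ k_bounds).
  by move=> q q_bounds; exact: a'.
have b'd : cond_b' -> cond_d.
  move=> b' f f_incr f_conv A1 A2 B1 B2 t A1p A2p B1p B2p t01.
  have Xp := HF _ _ (pd_comb A1p A2p t01) (pd_comb B1p B2p t01).
  apply: (inv_norms_convex_trf Xp (HF _ _ A1p B1p) (HF _ _ A2p B2p) t01) => //.
  by move=> k k_bounds; exact: b'.
have a'c : cond_a' -> cond_c.
  move=> a' f f_incr f_conc A1 A2 B1 B2 t A1p A2p B1p B2p t01.
  have Xp := HF _ _ (pd_comb A1p A2p t01) (pd_comb B1p B2p t01).
  apply: (antinorms_concave_trf Xp (HF _ _ A1p B1p) (HF _ _ A2p B2p) t01) => //.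
  by move=> k k_bounds; exact: a'.
have cd : cond_c -> cond_d.
  move=> c f f_incr f_conv A1 A2 B1 B2 t A1p A2p B1p B2p t01.
  have Xp := HF _ _ (pd_comb A1p A2p t01) (pd_comb B1p B2p t01).
  (* Condition (c) is applied to [u |-> - f u^-1], whose trace at a value of [F] is minus the trace
     of [f] at its inverse. *)
  have := c _ (nondecr_oppr_inv f_incr) (concave_oppr_inv f_incr f_conv)
    _ _ _ _ _ A1p A2p B1p B2p t01.
  rewrite !trfN -(trf_inv f Xp) -(trf_inv f (HF _ _ A1p B1p)).
  by rewrite -(trf_inv f (HF _ _ A2p B2p)) !mulrN -opprD lerN2.
split; last by split=> // a; exact/a'c/aa'.
by split=> //; split=> [a'|//]; exact/b'b/a'b'.
Qed.
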